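(* Let $p$ be a prime and $t\ge 1$ an integer. The Laplacian spectrum of the Co-Prime Order graph $\Theta(\mathbb{Z}_p^t)$ of the group $\mathbb{Z}_p^t$ consists of $0$ with multiplicity $1$ and $p^t$ with multiplicity $p^t-1$.
   Context: For a finite group $G$, the Co-Prime Order graph $\Theta(G)$ is the simple undirected graph with vertex set $G$ in which two distinct vertices $x,y$ are adjacent if and only if $\gcd(o(x),o(y))$ is $1$ or a prime, where $o(x)$ is the order of $x$. The Laplacian matrix of a finite simple graph $\Gamma$ is $L(\Gamma)=D(\Gamma)-A(\Gamma)$, with $D(\Gamma)$ the diagonal matrix of vertex degrees and $A(\Gamma)$ the adjacency matrix; the Laplacian spectrum is the multiset of eigenvalues of $L(\Gamma)$ (roots of its characteristic polynomial with multiplicity). $\mathbb{Z}_p^t$ is the direct product of $t$ copies of the cyclic group of order $p$. *)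

(* Defs.v *)
From HB Require Import structures.
From mathcomp Require Import all_boot all_order all_algebra all_fingroup.

Set Implicit Arguments.
Unset Strict Implicit.
Unset Printing Implicit Defensive.

Import GRing.Theory Num.Theory.
Local Open Scope ring_scope.

Record simple_graph (T : finType) := SimpleGraph {
  adj :> rel T;
  adj_sym : symmetric adj;
  adj_irr : irreflexive adj
}.

Definition deg (T : finType) (e : simple_graph T) (x : T) : nat := #|e x|.

(* The matrices of a graph on T have their rows and columns numbered along
   enum T: index i stands for the vertex enum_val i. *)
Definition adjacency_mx (R : nzRingType) (T : finType) (e : simple_graph T) :
    'M[R]_#|T| :=
  \matrix_(i, j) (e (enum_val i) (enum_val j))%:R.

Definition degree_mx (R : nzRingType) (T : finType) (e : simple_graph T) :
    'M[R]_#|T| :=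
  diag_mx (\row_i (deg e (enum_val i))%:R).

Definition laplacian_mx (R : nzRingType) (T : finType) (e : simple_graph T) :
    'M[R]_#|T| :=
  degree_mx R e - adjacency_mx R e.

(* The roots of the characteristic polynomial in an algebraically closed
   numeric field C (such as the complex numbers), each listed as many times as
   its multiplicity. A multiset is represented by a sequence up to perm_eq. *)
Definition laplacian_spectrum (C : numClosedFieldType) (T : finType)
    (e : simple_graph T) : seq C :=
  sval (closed_field_poly_normal (char_poly (laplacian_mx C e))).

Lemma char_poly_laplacian (C : numClosedFieldType) (T : finType)
    (e : simple_graph T) :
  char_poly (laplacian_mx C e)
    = \prod_(a <- laplacian_spectrum C e) ('X - a%:P).
Proof.
rewrite /laplacian_spectrum; case: closed_field_poly_normal => s /= def_p.
by rewrite [LHS]def_p (monicP (char_poly_monic _)) scale1r.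
Qed.

Definition coprime_order_rel (gT : finGroupType) : rel gT := fun x y =>
  let d := gcdn #[x]%g #[y]%g in (x != y) && ((d == 1%N) || prime d).

Lemma coprime_order_sym (gT : finGroupType) :
  symmetric (@coprime_order_rel gT).
Proof. by move=> x y; rewrite /coprime_order_rel eq_sym gcdnC. Qed.

Lemma coprime_order_irr (gT : finGroupType) :
  irreflexive (@coprime_order_rel gT).
Proof. by move=> x; rewrite /coprime_order_rel eqxx. Qed.

Definition coprime_order_graph (gT : finGroupType) : simple_graph gT :=
  SimpleGraph (@coprime_order_sym gT) (@coprime_order_irr gT).

(* The external direct product of t copies of the additive group 'Z_p, under
   the componentwise group law of gproduct. It is Z_p^t only for p > 1: both
   'Z_0 and 'Z_1 denote 'Z_2. *)
Definition Zp_power (p t : nat) : finGroupType :=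
  {dffun forall _ : 'I_t, ('Z_p : finGroupType)}.

(* Main.v *)
Require Import Defs.
From HB Require Import structures.
From mathcomp Require Import all_boot all_order all_algebra all_fingroup.
From mathcomp Require Import cyclic.

Set Implicit Arguments.
Unset Strict Implicit.
Unset Printing Implicit Defensive.

Import GRing.Theory Num.Theory.
Local Open Scope ring_scope.

(** Every element of an elementary abelian p-group has order 1 or p, so the gcd
    of any two orders is 1 or the prime p: the Co-Prime Order graph is complete
    ([coprime_order_graph_complete]). On n vertices the Laplacian of the
    complete graph is n I - J, with J the all-ones matrix. As J has rank one
    and maps the all-ones vector 1 to n 1, the matrix x I - (n I - J) is
    multiplication by x on the line spanned by 1 and by x - n on the quotient by
    that line, whence the characteristic polynomial x (x - n)^(n - 1)
    ([det_scalarD_const], [laplacian_spectrum_complete]). *)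

(** The all-ones vector is an eigenvector for a + n b, and modulo it the matrix
    is the scalar a, because all columns of the constant part are multiples of
    it. The change of basis that replaces the first basis vector by the all-ones
    vector therefore makes the matrix block triangular; it is unitriangular, so
    the identity holds over any commutative ring, polynomials included. *)
Lemma det_scalarD_const (R : comNzRingType) (n : nat) (a b : R) :
  (0 < n)%N -> \det (a%:M + const_mx b : 'M_n) = (a + b *+ n) * a ^+ n.-1.
Proof.
case: n => // m _ /=.
pose P : 'M[R]_(1 + m) := block_mx 1%:M 0 (const_mx 1) 1%:M.
pose T : 'M[R]_(1 + m) := block_mx (a + b *+ m.+1)%:M (const_mx b) 0 a%:M.
have sum_const k (f : 'I_k -> R) : (forall i, f i = b) -> \sum_i f i = b *+ k.
  by move=> fE; rewrite (eq_bigr _ (fun i _ => fE i)) sumr_const card_ord.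
have blockE : (a%:M + const_mx b : 'M[R]_(1 + m)) =
    block_mx (a + b)%:M (const_mx b) (const_mx b) (a%:M + const_mx b).
  rewrite (scalar_mx_block 1 m a) -[const_mx b]submxK add_block_mx.
  congr block_mx; apply/matrixP=> i j; rewrite !mxE ?add0r //.
  by rewrite !ord1 eqxx.
have PT : (a%:M + const_mx b) *m P = P *m T.
  rewrite blockE !mulmx_block mulmxDl (mul_scalar_mx a) !mulmx1 !mul1mx !mulmx0 !mul0mx !addr0 !add0r.
  congr block_mx; apply/matrixP=> i j; rewrite !mxE.
  - rewrite !ord1 eqxx sum_const; last by move=> k; rewrite !mxE mulr1.
    by rewrite -addrA -mulrS.
  - rewrite big_ord1 !mxE mul1r ord1 eqxx.
    rewrite sum_const; last by move=> k; rewrite !mxE mulr1.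
    by rewrite mulr1 mulr1n addrCA -mulrS.
  - by rewrite big_ord1 !mxE mul1r addrC.
have detP : \det P = 1 by rewrite /P det_lblock !det1 mulr1.
have := congr1 determinant PT.
by rewrite !det_mulmx detP mulr1 mul1r /T det_ublock !det_scalar expr1 => ->.
Qed.

Lemma laplacian_mx_complete (R : nzRingType) (T : finType)
    (e : simple_graph T) :
  (forall x y, e x y = (x != y)) ->
  laplacian_mx R e = #|T|%:R%:M - const_mx 1.
Proof.
move=> eE; apply/matrixP=> i j; rewrite !mxE eE (inj_eq enum_val_inj).
have -> : deg e (enum_val i) = #|T|.-1.
  rewrite /deg -(cardC1 (enum_val i)); apply: eq_card=> y.
  by rewrite !inE -topredE /= eE eq_sym.
have [_|_] := eqVneq i j; last by rewrite !mulr0n.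
have /prednK <- : (0 < #|T|)%N by apply/card_gt0P; exists (enum_val i).
by rewrite !mulr1n /= subr0 mulrSr addrK.
Qed.

(** A multiset of roots is determined by the monic polynomial that it splits,
    so it suffices to factor the characteristic polynomial. *)
Lemma laplacian_spectrum_complete (C : numClosedFieldType) (T : finType)
    (e : simple_graph T) :
  (0 < #|T|)%N -> (forall x y, e x y = (x != y)) ->
  perm_eq (laplacian_spectrum C e) (0 :: nseq #|T|.-1 #|T|%:R).
Proof.
move=> T_gt0 eE; apply: prod_XsubC_eq.
rewrite -char_poly_laplacian /char_poly.
have -> : char_poly_mx (laplacian_mx C e) =
    ('X - #|T|%:R%:P)%:M + const_mx 1 :> 'M_#|T|.
  apply/matrixP=> i j; rewrite laplacian_mx_complete // !mxE.
  by rewrite polyCB (polyCMn (i == j)) mulrnBl opprD opprK addrA.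
rewrite det_scalarD_const // big_cons big_nseq iter_mulr_1 subr0.
by rewrite rmorph_nat subrK.
Qed.

Lemma coprime_order_graph_complete (gT : finGroupType) (p : nat) :
  prime p -> (forall x : gT, x ^+ p = 1)%g ->
  forall x y : gT, coprime_order_graph gT x y = (x != y).
Proof.
move=> p_pr expp x y; rewrite /= /coprime_order_rel.
have : (gcdn #[x]%g #[y]%g %| p)%N.
  by rewrite (dvdn_trans (dvdn_gcdl _ _)) // order_dvdn expp.
by case/(primeP p_pr).2/orP=> /eqP->; rewrite ?p_pr ?eqxx ?orbT andbT.
Qed.

Lemma expg_Zp_power (p t : nat) (x : Zp_power p t) (n : nat) (i : 'I_t) :
  ((x ^+ n) i = x i ^+ n)%g.
Proof.
elim: n => [|n IHn]; first by rewrite !expg0 ffunE.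
by rewrite !expgS ffunE IHn.
Qed.

Lemma Zp_power_exponent (p t : nat) (x : Zp_power p t) :
  (1 < p)%N -> (x ^+ p = 1)%g.
Proof.
move=> p_gt1; apply/ffunP=> i; rewrite expg_Zp_power ffunE Zp_expg.
(* The modulus of 'Z_p is (Zp_trunc p).+2, equal to p only up to Zp_cast; the
   exponent is rewritten because the type of x depends on the modulus. *)
by apply: val_inj; rewrite /= -[X in (_ * X)%N](Zp_cast p_gt1) modnMl.
Qed.

Lemma card_Zp_power (p t : nat) : (1 < p)%N -> #|Zp_power p t| = (p ^ t)%N.
Proof. by move=> p_gt1; rewrite card_ffun !card_ord Zp_cast. Qed.

Theorem theorem3 (C : numClosedFieldType) (p t : nat)
    (p_prime : prime p) (t_ge1 : (1 <= t)%N) :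
  perm_eq (laplacian_spectrum C (coprime_order_graph (Zp_power p t)))
          (nseq 1 0 ++ nseq (p ^ t - 1)%N (p ^ t)%N%:R).
Proof.
have p_gt1 := prime_gt1 p_prime.
rewrite -(card_Zp_power t p_gt1) subn1.
apply: laplacian_spectrum_complete; last first.
  by apply: coprime_order_graph_complete p_prime _ => x; apply: Zp_power_exponent.
by rewrite card_Zp_power // expn_gt0 prime_gt0.
Qed.
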